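(* Let $d$ be a positive integer, let $H=(V,E)$ be a reduced $d$-flat hypergraph, and let $n=|V|$. Then $\|H\|=O(n^d)$.
   Context: A hypergraph is a pair $H=(V,E)$ with $V$ finite and $E\subseteq 2^V$; its size is $\|H\|=\sum_{e\in E}|e|$. For $d\ge1$, a $d$-semi-ladder in $H$ is a pair $(W,F)$ with $W=\{w_0,\ldots,w_d\}\subseteq V$, $F=\{f_0,\ldots,f_d\}\subseteq E$, $w_i\notin f_i$ for each $i$, and $w_i\in f_j$ whenever $i<j$. $H$ is $d$-flat if it has no $(d+1)$-semi-ladder. $H$ is reduced if $\bigcap_{e\in E}e=\emptyset$. *)

(* Defs.v *)
From mathcomp Require Import all_boot.

Set Implicit Arguments.
Unset Strict Implicit.
Unset Printing Implicit Defensive.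

Record hypergraph := Hypergraph {
  vertices : finType;
  edges : {set {set vertices}}
}.

Definition hsize (H : hypergraph) : nat := \sum_(e in edges H) #|e|.

(* The membership conditions force the d.+1 vertices w i to be pairwise
   distinct, and likewise the d.+1 edges f i, so no injectivity is required. *)
Definition semi_ladder (d : nat) (H : hypergraph)
    (W : {set vertices H}) (F : {set {set vertices H}}) : Prop :=
  exists (w : 'I_d.+1 -> vertices H) (f : 'I_d.+1 -> {set vertices H}),
    [/\ W = [set w i | i : 'I_d.+1],
        F = [set f i | i : 'I_d.+1],
        F \subset edges H,
        forall i, w i \notin f i
      & forall i j : 'I_d.+1, i < j -> w i \in f j].

Definition flat (d : nat) (H : hypergraph) : Prop :=
  ~ exists W F, @semi_ladder d.+1 H W F.

(* When there is no edge, the intersection is the whole vertex set. *)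
Definition reduced (H : hypergraph) : Prop :=
  \bigcap_(e in edges H) e = set0.

(* Main.v *)
Require Import Defs.
From mathcomp Require Import all_boot.

(** Let [E_v] be the set of edges containing [v]. If some edge avoids [v], a
    ladder in [E_v] can be extended at the front by [v] and that edge, so the
    longest ladder in [E_v] is shorter than the longest one in [E]. Since every
    edge other than the intersection of [E] contains such a [v], induction
    bounds the number of edges by O(n^k) when no ladder has k + 2 rungs.
    Finally, the size of [H] is the sum over [v] of the cardinals of the
    [E_v], and reducedness provides an edge avoiding [v] for every [v]. *)

(* Here [k] counts the rungs, so a [d]-semi-ladder is a ladder with [d.+1]. *)
Definition has_ladder {V : finType} (k : nat) (E : {set {set V}}) : Prop :=
  exists (w : 'I_k -> V) (f : 'I_k -> {set V}),
    [/\ forall i, f i \in E,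
        forall i, w i \notin f i
      & forall i j : 'I_k, i < j -> w i \in f j].

Definition star {V : finType} (E : {set {set V}}) (v : V) : {set {set V}} :=
  [set e in E | v \in e].

Lemma has_ladder0 {V : finType} {E : {set {set V}}} : has_ladder 0 E.
Proof.
have no0 (T : Type) : 'I_0 -> T by case.
by exists (no0 V), (no0 {set V}); split; case.
Qed.

Lemma has_ladder_cons {V : finType} {k : nat} {E : {set {set V}}} {v e} :
  e \in E -> v \notin e -> has_ladder k (star E v) -> has_ladder k.+1 E.
Proof.
move=> eE ve [w [f [fE wf wlt]]].
exists (fun i => if unlift ord0 i is Some j then w j else v).
exists (fun i => if unlift ord0 i is Some j then f j else e).
split=> [i|i|i j].
- by case: unliftP => // j _; move: (fE j); rewrite inE => /andP[].
- by case: unliftP => // j _; apply: wf.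
case: (unliftP ord0 j) => [j' ->|-> //].
case: (unliftP ord0 i) => [i' ->|_ _]; first by rewrite ltnS; apply: wlt.
(* The new rung comes first: [v] lies in every later edge [f j'] because these belong to
   [star E v]. *)
by move: (fE j'); rewrite inE => /andP[].
Qed.

Lemma star_no_ladder {V : finType} {k : nat} {E : {set {set V}}} {v} :
  ~ has_ladder k.+1 E -> v \notin \bigcap_(e in E) e ->
  ~ has_ladder k (star E v).
Proof.
move=> nE vI lad; apply: nE; move/bigcapP: vI => vI.
case: (pickP [pred e in E | v \notin e]) => [e /andP[eE ve]|none].
  exact: has_ladder_cons eE ve lad.
case: vI => e eE; move: (none e); rewrite /= eE /=.
by move/negbFE.
Qed.

(** An edge missing a vertex is by itself a ladder with one rung. *)
Lemma no_ladder1 {V : finType} {E : {set {set V}}} {e} :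
  ~ has_ladder 1 E -> e \in E -> e = setT.
Proof.
move=> nE eE; apply/setP => v; rewrite inE; apply/negPn/negP => ve.
by apply: nE; apply: has_ladder_cons eE ve (has_ladder0).
Qed.

Lemma bigcap_or_star {V : finType} {E : {set {set V}}} {e} :
  e \in E -> e != \bigcap_(f in E) f ->
  exists2 v, v \notin \bigcap_(f in E) f & e \in star E v.
Proof.
move=> eE neI; have /properP[_ [v ve vI]] : \bigcap_(f in E) f \proper e.
  by rewrite properEneq eq_sym neI bigcap_inf.
by exists v => //; rewrite inE eE.
Qed.

Lemma card_no_ladder {V : finType} (k : nat) (E : {set {set V}}) :
  0 < #|V| -> ~ has_ladder k.+2 E -> #|E| <= k.+2 * #|V| ^ k.
Proof.
move=> V0; elim: k E => [|k IHk] E nE; set I := \bigcap_(f in E) f.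
  (* The star of a vertex outside [I] has no ladder with one rung, so [setT] is its only possible
     edge. *)
  have sub : E \subset [set I; setT].
    apply/subsetP => e eE; rewrite !inE; case: eqVneq => //= neI.
    have [v vI ev] := bigcap_or_star eE neI.
    by rewrite (no_ladder1 (star_no_ladder nE vI) ev).
  apply: leq_trans (subset_leq_card sub) _.
  by rewrite cards2 muln1 ltnS leq_b1.
have sub : E \subset I |: \bigcup_(v in ~: I) star E v.
  apply/subsetP => e eE; rewrite !inE; case: eqVneq => //= neI.
  have [v vI ev] := bigcap_or_star eE neI.
  by apply/bigcupP; exists v; rewrite // inE.
apply: leq_trans (subset_leq_card sub) _.
apply: leq_trans (leq_card_setU _ _) _; rewrite cards1 [in leqRHS]mulSn.
(* The edge [I] is paid for by one extra [#|V| ^ k.+1], positive since [V] is nonempty; hence the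
   constant grows by one with [k]. *)
apply: leq_add; first by rewrite expn_gt0 V0.
apply: leq_trans (_ : \sum_(v in ~: I) #|star E v| <= _).
  elim/big_rec2: _ => [|v m A _ le]; first by rewrite cards0.
  by apply: leq_trans (leq_card_setU _ _) _; rewrite leq_add2l.
apply: leq_trans (_ : \sum_(v in ~: I) k.+2 * #|V| ^ k <= _).
  by apply: leq_sum => v; rewrite inE => vI; apply/IHk/star_no_ladder.
by rewrite sum_nat_const expnS mulnCA !leq_mul // max_card.
Qed.

Lemma hsize_sum_star (H : hypergraph) :
  hsize H = \sum_(v : vertices H) #|star (edges H) v|.
Proof.
rewrite /hsize; under eq_bigr do rewrite -sum1_card.
(* Double counting of the pairs with [v \in e]. *)
rewrite (exchange_big_dep predT) //=; apply: eq_bigr => v _.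
by rewrite sum1_card; apply: eq_card => e; rewrite !inE.
Qed.

(** Flatness forbids [d.+1]-semi-ladders, and these have [d.+2] rungs. *)
Lemma flat_no_ladder {d : nat} {H : hypergraph} :
  flat d H -> ~ has_ladder d.+2 (edges H).
Proof.
move=> fl [w [f [fE wf wlt]]]; apply: fl.
exists [set w i | i : 'I_d.+2], [set f i | i : 'I_d.+2], w, f; split=> //.
by apply/subsetP => _ /imsetP[i _ ->].
Qed.

Theorem theorem2 (d : nat) (hd : 0 < d) :
  exists C : nat, forall H : hypergraph,
    reduced H -> flat d H -> hsize H <= C * #|vertices H| ^ d.
Proof.
(* With [d = k.+1], [edges H] has no ladder with [k.+3] rungs, so no star has one with [k.+2]; the
   constant is that of [card_no_ladder] at [k]. *)
case: d hd => // k _; exists k.+2 => H red /flat_no_ladder nE.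
rewrite hsize_sum_star expnS mulnCA -sum_nat_const.
apply: leq_sum => v _; apply: card_no_ladder; first by apply/card_gt0P; exists v.
by apply: star_no_ladder nE _; rewrite red inE.
Qed.
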